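(* Suppose $c\geq a>0$ and $\{f_n\}_{n=0}^{\infty}$ is a nonnegative log-concave sequence without internal zeros. Let $$f_{a,c}(\mu;x)=\sum_{n=0}^{\infty}f_n\frac{(a+\mu)_n}{(c+\mu)_n}\frac{x^n}{n!},\qquad \phi_{a,c}(\mu,\nu;x)=f_{a,c}(\mu;x)f_{a,c}(\nu;x)-f_{a,c}(0;x)f_{a,c}(\mu+\nu;x).$$ Then the function $\mu\mapsto f_{a,c}(\mu;x)$ is discrete Wright log-concave on $[0,\infty)$ for each fixed $x>0$. Moreover, the family $\{f_{a,c}(\mu;x)\}_{\mu\geq 0}$ is discrete $q$-log-concave, i.e. $\phi_{a,c}(\mu,\nu;x)$ has nonnegative power series coefficients (in powers of $x$) for all $\nu\in\mathbb{N}$ and $\mu\geq\nu-1$, so that for such $\mu,\nu$ the function $x\mapsto\phi_{a,c}(\mu,\nu;x)$ is absolutely monotonic and multiplicatively convex on $(0,\infty)$.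
   Context: $\mathbb{N}$ is the set of positive integers; $(a)_0=1$, $(a)_n=a(a+1)\cdots(a+n-1)$ is the rising factorial. A nonnegative sequence $\{f_n\}_{n\ge0}$ is log-concave if $f_n^2\ge f_{n-1}f_{n+1}$ for all $n\ge1$; it has no internal zeros if $f_N=0$ implies that either $f_{N+i}=0$ for all $i\ge0$ or $f_{N-i}=0$ for $i=0,1,\dots,N$; log-concave sequences are also assumed non-trivial (not identically zero). A function $F:[0,\infty)\to[0,\infty)$ is discrete Wright log-concave if $F(\mu+\alpha)F(\mu+\beta)\ge F(\mu)F(\mu+\alpha+\beta)$ for all $\alpha\in\mathbb{N}$ and all $\mu,\beta\ge0$. A family $\{f(\mu;x)\}_{\mu\ge0}$ of formal power series in $x$ whose coefficients are nonnegative continuous functions of $\mu$ is discrete $q$-log-concave if $f(\mu+\alpha;x)f(\mu+\beta;x)-f(\mu;x)f(\mu+\alpha+\beta;x)$ has nonnegative coefficients at all powers of $x$ for all $\alpha\in\mathbb{N}$, $\beta\ge\alpha-1$ and $\mu\ge0$. A function is absolutely monotonic on an interval if it and all its derivatives are nonnegative there. A nonnegative function $\phi$ is multiplicatively convex if $\phi(x^{\lambda}y^{1-\lambda})\le\phi(x)^{\lambda}\phi(y)^{1-\lambda}$ for all $x,y$ in the interval and $\lambda\in[0,1]$. Power series are understood as formal; assertions about values at fixed $x$, or about functions of $x$ on $(0,\infty)$, are understood for those $x>0$ in the interval of convergence of the series. *)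

(* Defs.v *)
From Stdlib Require Export Reals Factorial.
From Coquelicot Require Export Coquelicot.

Open Scope R_scope.

Fixpoint rising (a : R) (n : nat) : R :=
  match n with
  | O => 1
  | S m => rising a m * (a + INR m)
  end.

Definition log_concave_seq (f : nat -> R) : Prop :=
  (forall n : nat, 0 <= f n) /\
  (exists n : nat, f n <> 0) /\
  (forall n : nat, (1 <= n)%nat -> f (n - 1)%nat * f (n + 1)%nat <= f n ^ 2).

Definition no_internal_zeros (f : nat -> R) : Prop :=
  forall N : nat, f N = 0 ->
    (forall i : nat, f (N + i)%nat = 0) \/
    (forall i : nat, (i <= N)%nat -> f (N - i)%nat = 0).

(* A function on [0, oo) is represented by a total function on R of which only
   the restriction to [0, oo) is constrained. *)
Definition discrete_Wright_log_concave (F : R -> R) : Prop :=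
  (forall mu : R, 0 <= mu -> 0 <= F mu) /\
  (forall (alpha : nat) (mu beta : R),
     (1 <= alpha)%nat -> 0 <= mu -> 0 <= beta ->
     F mu * F (mu + INR alpha + beta) <= F (mu + INR alpha) * F (mu + beta)).

(* A formal power series in x is its coefficient sequence [nat -> R]; the
   product of formal power series is the Cauchy product [PS_mult]. *)
Definition nonneg_coefs (p : nat -> R) : Prop := forall n : nat, 0 <= p n.

Definition discrete_q_log_concave (p : R -> nat -> R) : Prop :=
  (forall mu : R, 0 <= mu -> nonneg_coefs (p mu)) /\
  (forall n : nat, continuous_on (fun mu : R => 0 <= mu) (fun mu : R => p mu n)) /\
  (forall (alpha : nat) (beta mu : R),
     (1 <= alpha)%nat -> INR alpha - 1 <= beta -> 0 <= mu ->
     nonneg_coefs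
       (PS_minus (PS_mult (p (mu + INR alpha)) (p (mu + beta)))
                 (PS_mult (p mu) (p (mu + INR alpha + beta))))).

(* The interval I is meant to be open, as [Derive_n] is two-sided. *)
Definition absolutely_monotonic (I : R -> Prop) (g : R -> R) : Prop :=
  forall (n : nat) (x : R), I x -> ex_derive_n g n x /\ 0 <= Derive_n g n x.

(* [Rpower 0 l] is 1 for every l, because [ln 0 = 0]; here 0 ^ l = 0 for l <> 0
   and 0 ^ 0 = 1. *)
Definition real_power (x l : R) : R :=
  if Req_EM_T x 0 then (if Req_EM_T l 0 then 1 else 0) else Rpower x l.

Definition multiplicatively_convex (I : R -> Prop) (g : R -> R) : Prop :=
  (forall x : R, I x -> 0 <= g x) /\
  (forall x y l : R, I x -> I y -> 0 <= l <= 1 ->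
     g (real_power x l * real_power y (1 - l)) <=
     real_power (g x) l * real_power (g y) (1 - l)).

Definition f_coef (f : nat -> R) (a c mu : R) (n : nat) : R :=
  f n * (rising (a + mu) n / rising (c + mu) n) / INR (fact n).

Definition f_val (f : nat -> R) (a c mu x : R) : R :=
  PSeries (f_coef f a c mu) x.

Definition phi_coef (f : nat -> R) (a c mu nu : R) : nat -> R :=
  PS_minus (PS_mult (f_coef f a c mu) (f_coef f a c nu))
           (PS_mult (f_coef f a c 0) (f_coef f a c (mu + nu))).

Definition phi_val (f : nat -> R) (a c mu nu x : R) : R :=
  f_val f a c mu x * f_val f a c nu x - f_val f a c 0 x * f_val f a c (mu + nu) x.

(* Main.v *)
Require Import Defs.
From Stdlib Require Import Lra Lia FunctionalExtensionality Classical.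

(** Why the theorem holds.  Everything follows from the effect of raising one
    parameter by one: for [b >= 0] the coefficients of
    [f(mu + 1; x) f(mu + b; x) - f(mu; x) f(mu + 1 + b; x)] are nonnegative.
    Replacing [a], [c] by [a + mu], [c + mu] reduces this to [mu = 0], which is
    [log_concave_kummer_turan].

    The coefficient of [x^m] is a sum of [f k * f (m - k) * M k], where [M]
    does not depend on [f].  After [M k] and [M (m - k)] are added together, the
    terms are symmetric under [k -> m - k] and, as [k] grows to [m / 2], pass at
    most once from negative to nonnegative ([symmetrised_sign]).  This rests on
    the behaviour of [(a + 1)_n (c)_n / ((c + 1)_n (a)_n)], which grows with [n],
    decreases when [a] and [c] are raised by the same amount, and does so by an
    amount that is concave in [n] ([shift_factor_gap_concave]); also, the quotient
    of [(a + b)_n / (c + b)_n] by [(a)_n / (c)_n] grows with [n].  By log-concavity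
    [f k * f (m - k)] increases up to [m / 2], so it weighs the nonnegative terms
    more than the negative ones; hence the sum is nonnegative as soon as it is
    for constant [f] ([sum_weighted_nonneg]).

    For constant [f] the series are Kummer's functions 1F1, and the expression
    is essentially a Wronskian of two of them.  Kummer's differential equation
    turns into a first order equation for it, whose inhomogeneous part has
    nonnegative coefficients; its own coefficients are then nonnegative by
    induction ([kummer_turan]).

    From the unit shift, a chain of [nu] inequalities gives the coefficients of
    [phi] for [mu >= nu - 1] ([f_coef_q_log_concave]).  For the values at a fixed
    [x], which are positive, the unit shift says that [f(mu + 1; x) / f(mu; x)]
    does not increase with [mu], and multiplying such ratios removes the
    restriction on [mu] ([Wright_log_concave_of_unit_shift]).  Finally an entire
    series with nonnegative coefficients is absolutely monotonic term by term,
    and multiplicatively convex by Hoelder's inequality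
    ([PSeries_multiplicatively_convex]). *)

(** * Finite sums *)

Lemma sum_rev (g : nat -> R) (n : nat) :
  sum_f_R0 (fun k => g (n - k)%nat) n = sum_f_R0 g n.
Proof.
  induction n as [|n IH]; [reflexivity|].
  rewrite decomp_sum by lia. simpl pred.
  replace (S n - 0)%nat with (S n) by lia.
  cbn [sum_f_R0]. rewrite <- IH, Rplus_comm. f_equal.
Qed.

(** There is a threshold [G >= 0] that separates the weights of the negative
    terms from those of the nonnegative ones, so that [g k * A k >= G * A k]
    for every [k] and the weighted sum is at least [G] times the plain one. *)
Lemma sum_weighted_nonneg (g A : nat -> R) (m : nat) :
  (forall k, (k <= m)%nat -> 0 <= g k) ->
  (forall i j, (i <= m)%nat -> (j <= m)%nat -> A i < 0 -> 0 <= A j -> g i <= g j) ->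
  0 <= sum_f_R0 A m -> 0 <= sum_f_R0 (fun k => g k * A k) m.
Proof.
  intros Hg Hsep HA.
  assert (Hthr : forall n, (n <= m)%nat -> exists G, 0 <= G /\
    (forall i, (i <= n)%nat -> A i < 0 -> g i <= G) /\
    (forall j, (j <= m)%nat -> 0 <= A j -> G <= g j)).
  { induction n as [|n IH]; intros Hn.
    - destruct (Rlt_le_dec (A 0%nat) 0) as [H0|H0].
      + exists (g 0%nat). repeat split; [apply Hg; lia| |].
        * intros i Hi _. replace i with 0%nat by lia. lra.
        * intros j Hj HAj. apply Hsep; trivial; lia.
      + exists 0. repeat split; [lra| |].
        * intros i Hi HAi. replace i with 0%nat in HAi by lia. lra.
        * intros j Hj _. apply Hg; lia.
    - destruct IH as (G & HG0 & HG1 & HG2); [lia|].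
      destruct (Rlt_le_dec (A (S n)) 0) as [H0|H0].
      + exists (Rmax G (g (S n))). repeat split.
        * apply Rle_trans with G; [trivial|apply Rmax_l].
        * intros i Hi HAi. destruct (Nat.eq_dec i (S n)) as [->|Hne].
          -- apply Rmax_r.
          -- apply Rle_trans with G; [apply HG1; trivial; lia|apply Rmax_l].
        * intros j Hj HAj. apply Rmax_lub; [auto|apply Hsep; trivial; lia].
      + exists G. repeat split; trivial.
        intros i Hi HAi. destruct (Nat.eq_dec i (S n)) as [->|Hne]; [lra|].
        apply HG1; trivial; lia. }
  destruct (Hthr m) as (G & HG0 & HG1 & HG2); [lia|].
  apply Rle_trans with (G * sum_f_R0 A m); [apply Rmult_le_pos; trivial|].
  rewrite scal_sum. apply sum_Rle. intros k Hk.
  destruct (Rlt_le_dec (A k) 0) as [H0|H0].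
  - specialize (HG1 k Hk H0). nra.
  - specialize (HG2 k Hk H0). nra.
Qed.

(** * Log-concave sequences *)

(** The absence of internal zeros is what lets the induction on [l - k] divide by
    [f l]: if [f l = 0] then [f k] or [f (l + 2)] vanishes too.  The inequality
    says that the ratios [f (n+1) / f n] do not increase. *)
Lemma log_concave_spread (f : nat -> R) :
  log_concave_seq f -> no_internal_zeros f ->
  forall k l, (k <= l)%nat -> f k * f (S l) <= f (S k) * f l.
Proof.
  intros (Hpos & _ & Hlc) Hz k l Hkl.
  induction Hkl as [|l Hkl IH]; [lra|].
  assert (Hzero : f l = 0 -> f k * f (S (S l)) = 0).
  { intros H0. destruct (Hz l H0) as [H|H].
    - specialize (H 2%nat). replace (l + 2)%nat with (S (S l)) in H by lia.
      rewrite H; ring.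
    - specialize (H (l - k)%nat ltac:(lia)).
      replace (l - (l - k))%nat with k in H by lia. rewrite H; ring. }
  specialize (Hlc (S l) ltac:(lia)).
  replace (S l - 1)%nat with l in Hlc by lia.
  replace (S l + 1)%nat with (S (S l)) in Hlc by lia.
  pose proof (Hpos k) as Pk. pose proof (Hpos l) as Pl.
  pose proof (Hpos (S l)) as PSl. pose proof (Hpos (S k)) as PSk.
  destruct (Req_dec (f l) 0) as [H0|H0].
  - rewrite Hzero by trivial. apply Rmult_le_pos; trivial.
  - apply Rmult_le_reg_l with (f l); [lra|].
    apply Rle_trans with (f k * f (S l) * f (S l)).
    + apply Rmult_le_compat_l with (r := f k) in Hlc; [|trivial]. lra.
    + apply Rmult_le_compat_r with (r := f (S l)) in IH; [|trivial]. lra.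
Qed.

Lemma log_concave_unimodal (f : nat -> R) (m : nat) :
  log_concave_seq f -> no_internal_zeros f ->
  forall i k, (i <= k)%nat -> (2 * k <= m)%nat ->
  f i * f (m - i)%nat <= f k * f (m - k)%nat.
Proof.
  intros Hf Hz i k Hik. induction Hik as [|k Hik IH]; intros Hk; [lra|].
  apply Rle_trans with (f k * f (m - k)%nat); [apply IH; lia|].
  replace (m - k)%nat with (S (m - S k)) by lia.
  apply log_concave_spread; trivial; lia.
Qed.

(** Past an index [N] with [f N > 0] the ratios [f (n+1) / f n] are at most
    [f (N+1) / f N].  Growth at this rate is absorbed by the factorials of an
    exponential series. *)
Lemma log_concave_geometric_bound (f : nat -> R) :
  log_concave_seq f -> no_internal_zeros f ->
  exists C K, 0 <= C /\ 1 <= K /\ forall n, f n <= C * K ^ n.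
Proof.
  intros Hf Hz. pose proof Hf as (Hpos & (N & HN) & _).
  assert (HN' : 0 < f N) by (specialize (Hpos N); lra).
  set (K := Rmax 1 (f (S N) / f N)).
  assert (HK : 1 <= K) by apply Rmax_l.
  assert (Hratio : forall n, (N <= n)%nat -> f (S n) <= K * f n).
  { intros n Hn. pose proof (log_concave_spread f Hf Hz N n Hn) as H.
    apply Rle_trans with (f (S N) / f N * f n).
    - apply Rmult_le_reg_l with (f N); [trivial|]. field_simplify; lra.
    - apply Rmult_le_compat_r; [trivial|apply Rmax_r]. }
  assert (HC : forall n, f n <= sum_f_R0 f n).
  { intros [|n]; simpl; [lra|]. pose proof (cond_pos_sum f n Hpos). lra. }
  exists (sum_f_R0 f N), K. split; [apply cond_pos_sum; trivial|].
  split; [trivial|]. intros n.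
  assert (Hpow : forall k, 1 <= K ^ k) by (intros; apply pow_R1_Rle; trivial).
  destruct (Nat.le_gt_cases N n) as [Hn|Hn].
  - induction Hn as [|n Hn IH].
    + specialize (HC N). specialize (Hpow N). pose proof (cond_pos_sum f N Hpos). nra.
    + apply Rle_trans with (K * f n); [auto|]. simpl. nra.
  - assert (H : sum_f_R0 f n <= sum_f_R0 f N).
    { rewrite (tech2 f n N) by trivial.
      pose proof (cond_pos_sum (fun i => f (S n + i)%nat) (N - S n) (fun i => Hpos _)).
      simpl in *. lra. }
    specialize (HC n). specialize (Hpow n). pose proof (cond_pos_sum f N Hpos). nra.
Qed.

(** * The single sign change *)

(** With [d = s - r], the expression [rho k * (s l - r k) + rho l * (s k - r l)]
    equals [rho k * (d k + d l) - (rho l - rho k) * (r l - s k)].  Moving [k] and [l]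
    towards each other makes the first product larger, as [rho] increases and
    [d] is concave, and
    makes both factors of the second one smaller; once [r l - s k] is negative,
    nonnegativity is immediate. *)
Lemma symmetrised_sign_step (rho s r : nat -> R) :
  (forall n, 0 <= rho n <= rho (S n)) ->
  (forall n, r n <= r (S n)) -> (forall n, s n <= s (S n)) ->
  (forall n, r n <= s n) ->
  (forall n, (s n - r n) + (s (S (S n)) - r (S (S n))) <= 2 * (s (S n) - r (S n))) ->
  forall k l, (k < l)%nat ->
  0 <= rho k * (s (S l) - r k) + rho (S l) * (s k - r (S l)) ->
  0 <= rho (S k) * (s l - r (S k)) + rho l * (s (S k) - r l).
Proof.
  intros Hrho Hr Hs Hrs Hconc k l Hkl H.
  assert (Hmono : forall i j, (i <= j)%nat -> rho i <= rho j).
  { intros i j Hij. induction Hij as [|j _ IH]; [lra|]. specialize (Hrho j). lra. }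
  assert (Hd : (s k - r k) + (s (S l) - r (S l)) <= (s (S k) - r (S k)) + (s l - r l)).
  { induction Hkl as [|l Hkl IH].
    - specialize (Hconc k). lra.
    - assert (Hdec : forall i j, (i <= j)%nat ->
        (s (S j) - r (S j)) - (s j - r j) <= (s (S i) - r (S i)) - (s i - r i)).
      { intros i j Hij. induction Hij as [|j _ IHj]; [lra|].
        specialize (Hconc j). lra. }
      specialize (Hdec k (S l) ltac:(lia)). lra. }
  pose proof (Hmono (S k) l ltac:(lia)) as M1.
  pose proof (Hrho k) as M2. pose proof (Hrho l) as M3.
  pose proof (Hr l) as M4. pose proof (Hs k) as M5.
  pose proof (Hrs (S k)) as M6. pose proof (Hrs l) as M7.
  pose proof (Hrs k) as M8. pose proof (Hrs (S l)) as M9.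
  set (D := (s k - r k) + (s (S l) - r (S l))) in *.
  set (D' := (s (S k) - r (S k)) + (s l - r l)) in *.
  replace (rho (S k) * (s l - r (S k)) + rho l * (s (S k) - r l))
    with (rho (S k) * D' - (rho l - rho (S k)) * (r l - s (S k)))
    by (unfold D'; ring).
  assert (H' : (rho (S l) - rho k) * (r (S l) - s k) <= rho k * D)
    by (unfold D; lra).
  assert (HD : 0 <= D) by (unfold D; lra).
  assert (HDD : rho k * D <= rho (S k) * D') by (apply Rmult_le_compat; lra).
  destruct (Rle_lt_dec (r l - s (S k)) 0) as [Hneg|Hposi].
  - assert (0 <= rho k * D) by (apply Rmult_le_pos; lra). nra.
  - assert ((rho l - rho (S k)) * (r l - s (S k))
            <= (rho (S l) - rho k) * (r (S l) - s k))
      by (apply Rmult_le_compat; lra).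
    lra.
Qed.

Lemma symmetrised_sign (rho s r : nat -> R) (m : nat) :
  (forall n, 0 <= rho n <= rho (S n)) ->
  (forall n, r n <= r (S n)) -> (forall n, s n <= s (S n)) ->
  (forall n, r n <= s n) ->
  (forall n, (s n - r n) + (s (S (S n)) - r (S (S n))) <= 2 * (s (S n) - r (S n))) ->
  forall i k, (i <= k)%nat -> (2 * k <= m)%nat ->
  0 <= rho i * (s (m - i)%nat - r i) + rho (m - i)%nat * (s i - r (m - i)%nat) ->
  0 <= rho k * (s (m - k)%nat - r k) + rho (m - k)%nat * (s k - r (m - k)%nat).
Proof.
  intros Hrho Hr Hs Hrs Hconc i k Hik.
  induction Hik as [|k Hik IH]; intros Hk H; [trivial|].
  apply symmetrised_sign_step; trivial; [lia|].
  replace (S (m - S k)) with (m - k)%nat by lia. apply IH; trivial; lia.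
Qed.

(** * Ratios of rising factorials *)

Definition poch_ratio (a c : R) (n : nat) : R := rising a n / rising c n.

(** The factor by which [poch_ratio a c n] grows when [a] and [c] are both
    increased by one. *)
Definition shift_factor (a c : R) (n : nat) : R :=
  c * (a + INR n) / (a * (c + INR n)).

Lemma rising_pos (a : R) (n : nat) : 0 < a -> 0 < rising a n.
Proof.
  intros Ha. induction n as [|n IH]; simpl; [lra|].
  apply Rmult_lt_0_compat; [trivial|]. pose proof (pos_INR n). lra.
Qed.

Lemma rising_shift (a : R) (n : nat) : rising a (S n) = a * rising (a + 1) n.
Proof.
  induction n as [|n IH]; [simpl; ring|].
  change (rising a (S (S n))) with (rising a (S n) * (a + INR (S n))).
  rewrite IH, S_INR. simpl. ring.
Qed.

Lemma poch_ratio_pos (a c : R) (n : nat) : 0 < a -> 0 < c -> 0 < poch_ratio a c n.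
Proof. intros. apply Rdiv_lt_0_compat; apply rising_pos; trivial. Qed.

Lemma poch_ratio_S (a c : R) (n : nat) :
  0 < c -> poch_ratio a c (S n) = poch_ratio a c n * ((a + INR n) / (c + INR n)).
Proof.
  intros Hc. unfold poch_ratio. simpl.
  pose proof (rising_pos c n Hc). pose proof (pos_INR n). field. lra.
Qed.

Lemma poch_ratio_shift (a c : R) (n : nat) :
  0 < a -> 0 < c ->
  poch_ratio (a + 1) (c + 1) n = poch_ratio a c n * shift_factor a c n.
Proof.
  intros Ha Hc. unfold poch_ratio, shift_factor.
  pose proof (rising_shift a n) as H1. pose proof (rising_shift c n) as H2.
  simpl in H1, H2. pose proof (pos_INR n).
  pose proof (rising_pos c n Hc). pose proof (rising_pos (c + 1) n ltac:(lra)).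
  replace (rising (a + 1) n) with (rising a n * (a + INR n) / a)
    by (rewrite H1; field; lra).
  replace (rising (c + 1) n) with (rising c n * (c + INR n) / c)
    by (rewrite H2; field; lra).
  field. lra.
Qed.

Lemma poch_ratio_le_1 (a c : R) (n : nat) :
  0 < a -> a <= c -> poch_ratio a c n <= 1.
Proof.
  intros Ha Hac. induction n as [|n IH]; [unfold poch_ratio; simpl; lra|].
  rewrite poch_ratio_S by lra. pose proof (pos_INR n).
  pose proof (poch_ratio_pos a c n Ha ltac:(lra)).
  assert (0 <= (a + INR n) / (c + INR n)) by (apply Rdiv_le_0_compat; lra).
  assert ((a + INR n) / (c + INR n) <= 1) by (apply Rle_div_l; lra).
  nra.
Qed.

Lemma fraction_shift_le (a c b : R) :
  0 < a -> a <= c -> 0 <= b -> a / c <= (a + b) / (c + b).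
Proof.
  intros Ha Hac Hb. apply Rle_div_l; [lra|].
  replace ((a + b) / (c + b) * c) with ((a + b) * c / (c + b)) by (field; lra).
  apply Rle_div_r; [lra|]. nra.
Qed.

Lemma shift_factor_form (a c : R) (n : nat) :
  0 < a -> 0 < c ->
  shift_factor a c n = 1 + INR n * (c - a) * (/ a * / (c + INR n)).
Proof.
  intros. unfold shift_factor. pose proof (pos_INR n). field. lra.
Qed.

Lemma shift_factor_ge_1 (a c : R) (n : nat) :
  0 < a -> a <= c -> 1 <= shift_factor a c n.
Proof.
  intros Ha Hac. rewrite shift_factor_form by lra. pose proof (pos_INR n).
  assert (0 <= INR n * (c - a) * (/ a * / (c + INR n))).
  { apply Rmult_le_pos; [apply Rmult_le_pos; lra|].
    apply Rmult_le_pos; apply Rlt_le, Rinv_0_lt_compat; lra. }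
  lra.
Qed.

Lemma shift_factor_mono (a c : R) (n : nat) :
  0 < a -> a <= c -> shift_factor a c n <= shift_factor a c (S n).
Proof.
  intros Ha Hac. pose proof (pos_INR n).
  assert (E : shift_factor a c (S n) - shift_factor a c n
    = c * (c - a) / (a * (c + INR n) * (c + INR n + 1))).
  { unfold shift_factor. rewrite S_INR. field. lra. }
  assert (0 <= c * (c - a) / (a * (c + INR n) * (c + INR n + 1))).
  { apply Rdiv_le_0_compat; [apply Rmult_le_pos; lra|].
    repeat apply Rmult_lt_0_compat; lra. }
  lra.
Qed.

Lemma shift_factor_antitone (a c b : R) (n : nat) :
  0 < a -> a <= c -> 0 <= b ->
  shift_factor (a + b) (c + b) n <= shift_factor a c n.
Proof.
  intros Ha Hac Hb. pose proof (pos_INR n).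
  rewrite !shift_factor_form by lra.
  replace (c + b - (a + b)) with (c - a) by ring.
  apply Rplus_le_compat_l, Rmult_le_compat_l; [apply Rmult_le_pos; lra|].
  apply Rmult_le_compat; try (apply Rlt_le, Rinv_0_lt_compat; lra);
    apply Rinv_le_contravar; lra.
Qed.

(** The second difference of [shift_factor a c] is
    [- 2 (c - a) * (c / a) / ((c + n) (c + n + 1) (c + n + 2))], whose absolute
    value decreases when [a] and [c] are increased by the same amount. *)
Lemma shift_factor_gap_concave (a c b : R) (n : nat) :
  0 < a -> a <= c -> 0 <= b ->
  let d k := shift_factor a c k - shift_factor (a + b) (c + b) k in
  d n + d (S (S n)) <= 2 * d (S n).
Proof.
  intros Ha Hac Hb d. pose proof (pos_INR n).
  assert (E : forall a' c', 0 < a' -> 0 < c' ->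
    shift_factor a' c' n + shift_factor a' c' (S (S n)) - 2 * shift_factor a' c' (S n)
    = - (2 * (c' - a') * (c' / a' * / ((c' + INR n) * (c' + INR n + 1) * (c' + INR n + 2))))).
  { intros a' c' Ha' Hc'. unfold shift_factor. rewrite !S_INR. field. lra. }
  pose proof (E a c Ha ltac:(lra)) as E1.
  pose proof (E (a + b) (c + b) ltac:(lra) ltac:(lra)) as E2.
  assert (L : 2 * (c + b - (a + b)) *
      ((c + b) / (a + b) * / ((c + b + INR n) * (c + b + INR n + 1) * (c + b + INR n + 2)))
    <= 2 * (c - a) * (c / a * / ((c + INR n) * (c + INR n + 1) * (c + INR n + 2)))).
  { replace (c + b - (a + b)) with (c - a) by ring.
    assert (P1 : 0 < (c + INR n) * (c + INR n + 1)) by (apply Rmult_lt_0_compat; lra).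
    assert (P2 : 0 < (c + b + INR n) * (c + b + INR n + 1)) by (apply Rmult_lt_0_compat; lra).
    apply Rmult_le_compat_l; [lra|]. apply Rmult_le_compat.
    - apply Rdiv_le_0_compat; lra.
    - apply Rlt_le, Rinv_0_lt_compat, Rmult_lt_0_compat; lra.
    - apply Rle_div_l; [lra|].
      replace (c / a * (a + b)) with (c * (a + b) / a) by (field; lra).
      apply Rle_div_r; [lra|]. nra.
    - apply Rinv_le_contravar; [apply Rmult_lt_0_compat; lra|].
      apply Rmult_le_compat; try lra. apply Rmult_le_compat; lra. }
  unfold d. lra.
Qed.

(** * Cauchy products *)

Lemma PS_mult_comm (p q : nat -> R) (n : nat) : PS_mult p q n = PS_mult q p n.
Proof.
  unfold PS_mult. rewrite <- (sum_rev (fun k => q k * p (n - k)%nat)).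
  apply sum_eq. intros k Hk. replace (n - (n - k))%nat with k by lia. ring.
Qed.

Lemma PS_mult_incr_l (p q : nat -> R) (n : nat) :
  PS_mult (PS_incr_1 p) q (S n) = PS_mult p q n.
Proof.
  unfold PS_mult. rewrite decomp_sum by lia. simpl.
  unfold zero; simpl. ring.
Qed.

Lemma PS_mult_incr_r (p q : nat -> R) (n : nat) :
  PS_mult p (PS_incr_1 q) (S n) = PS_mult p q n.
Proof. rewrite PS_mult_comm, PS_mult_incr_l. apply PS_mult_comm. Qed.

Lemma PS_mult_nonneg (p q : nat -> R) :
  nonneg_coefs p -> nonneg_coefs q -> nonneg_coefs (PS_mult p q).
Proof.
  intros Hp Hq n. apply cond_pos_sum. intros k. apply Rmult_le_pos; [apply Hp|apply Hq].
Qed.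

(** * Kummer's function *)

(** The coefficients of the confluent hypergeometric function 1F1(a; c; x). *)
Definition kummer_coef (a c : R) (n : nat) : R := poch_ratio a c n / INR (fact n).

Lemma kummer_coef_nonneg (a c : R) :
  0 < a -> 0 < c -> nonneg_coefs (kummer_coef a c).
Proof.
  intros Ha Hc n. apply Rlt_le, Rdiv_lt_0_compat; [apply poch_ratio_pos; trivial|].
  apply INR_fact_lt_0.
Qed.

Lemma kummer_coef_shift (a c : R) (n : nat) :
  0 < a -> 0 < c ->
  kummer_coef (a + 1) (c + 1) n = kummer_coef a c n * shift_factor a c n.
Proof.
  intros. unfold kummer_coef. rewrite poch_ratio_shift by trivial.
  field. apply INR_fact_neq_0.
Qed.

(** The derivative of 1F1(a; c; x) is a/c times 1F1(a + 1; c + 1; x); both sides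
    are multiplied by x here. *)
Lemma kummer_euler (a c : R) (n : nat) :
  0 < a -> 0 < c ->
  INR n * kummer_coef a c n = a / c * PS_incr_1 (kummer_coef (a + 1) (c + 1)) n.
Proof.
  intros Ha Hc. destruct n as [|n]; [simpl; unfold zero; simpl; ring|].
  cbn [PS_incr_1]. unfold kummer_coef.
  rewrite poch_ratio_shift, poch_ratio_S by lra.
  rewrite fact_simpl, mult_INR. unfold shift_factor.
  pose proof (pos_INR n). pose proof (INR_fact_neq_0 n). rewrite S_INR. field. lra.
Qed.

(** Kummer's equation [x y'' + (c - x) y' = a y] for y = 1F1(a; c; x), multiplied
    by c/a and written with P = (c/a) y' as [x P' + c P = c y + x P]. *)
Lemma kummer_ode (a c : R) (n : nat) :
  0 < a -> 0 < c ->
  (INR n + c) * kummer_coef (a + 1) (c + 1) n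
  = c * kummer_coef a c n + PS_incr_1 (kummer_coef (a + 1) (c + 1)) n.
Proof.
  intros Ha Hc.
  replace (PS_incr_1 (kummer_coef (a + 1) (c + 1)) n)
    with (c / a * (INR n * kummer_coef a c n))
    by (rewrite kummer_euler by trivial; field; lra).
  rewrite kummer_coef_shift by trivial. unfold shift_factor.
  pose proof (pos_INR n). field. lra.
Qed.

(** Let P, y be the series with parameters a + 1 and a, let Q, z be those with
    parameters a + b + 1 and a + b, and let W = P z - y Q.  Kummer's equation
    gives
    [x W' + c W = x W + ((a + b)/(c + b) - a/c) x P Q + b y (Q - z)],
    in which the last two terms have nonnegative coefficients; so the
    coefficients of W are nonnegative by induction. *)
Lemma kummer_turan (a c b : R) (m : nat) :
  0 < a -> a <= c -> 0 <= b ->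
  PS_mult (kummer_coef a c) (kummer_coef (a + b + 1) (c + b + 1)) m
  <= PS_mult (kummer_coef (a + 1) (c + 1)) (kummer_coef (a + b) (c + b)) m.
Proof.
  intros Ha Hac Hb.
  set (P := kummer_coef (a + 1) (c + 1)). set (y := kummer_coef a c).
  set (Q := kummer_coef (a + b + 1) (c + b + 1)). set (z := kummer_coef (a + b) (c + b)).
  assert (Hy : nonneg_coefs y) by (apply kummer_coef_nonneg; lra).
  assert (HP : nonneg_coefs P) by (apply kummer_coef_nonneg; lra).
  assert (Hz : nonneg_coefs z) by (apply kummer_coef_nonneg; lra).
  assert (HQ : nonneg_coefs Q) by (apply kummer_coef_nonneg; lra).
  assert (Hzq : forall n, z n <= Q n).
  { intros n. unfold Q, z. rewrite kummer_coef_shift by lra.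
    pose proof (shift_factor_ge_1 (a + b) (c + b) n ltac:(lra) ltac:(lra)).
    specialize (Hz n). unfold z in Hz. nra. }
  assert (Hfrac := fraction_shift_le a c b Ha Hac Hb).
  set (q := fun n => Q n - z n).
  assert (Hq : nonneg_coefs q) by (intros n; specialize (Hzq n); unfold q; lra).
  assert (Hrec : forall m, (INR m + c) * (PS_mult P z m - PS_mult y Q m)
    = (PS_mult (PS_incr_1 P) z m - PS_mult y (PS_incr_1 Q) m)
      + ((a + b) / (c + b) * PS_mult P (PS_incr_1 Q) m
         - a / c * PS_mult (PS_incr_1 P) Q m)
      + b * PS_mult y q m).
  { intros n. unfold PS_mult.
    rewrite !scal_sum, <- !minus_sum, scal_sum, <- !plus_sum.
    apply sum_eq. intros k Hk.
    pose proof (kummer_ode a c k Ha ltac:(lra)) as O1.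
    pose proof (kummer_euler a c k Ha ltac:(lra)) as U1.
    pose proof (kummer_ode (a + b) (c + b) (n - k) ltac:(lra) ltac:(lra)) as O2.
    pose proof (kummer_euler (a + b) (c + b) (n - k) ltac:(lra) ltac:(lra)) as U2.
    rewrite minus_INR in O2, U2 by trivial.
    fold P y in O1, U1. fold Q z in O2, U2. unfold q.
    set (Pk := P k) in *. set (yk := y k) in *.
    set (Ql := Q (n - k)%nat) in *. set (zl := z (n - k)%nat) in *.
    set (IP := PS_incr_1 P k) in *. set (IQ := PS_incr_1 Q (n - k)) in *.
    transitivity (((INR k + c) * Pk) * zl + Pk * ((INR n - INR k) * zl)
      - yk * ((INR n - INR k + (c + b)) * Ql) + b * yk * Ql - (INR k * yk) * Ql).
    - ring.
    - rewrite O1, U1, O2, U2. ring. }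
  induction m as [|m IH].
  - unfold PS_mult, P, y, Q, z, kummer_coef, poch_ratio. simpl. lra.
  - specialize (Hrec (S m)).
    rewrite !PS_mult_incr_l, !PS_mult_incr_r in Hrec.
    pose proof (PS_mult_nonneg P Q HP HQ m) as N1.
    pose proof (PS_mult_nonneg y q Hy Hq (S m)) as N2.
    pose proof (pos_INR (S m)) as Hm.
    assert (0 <= b * PS_mult y q (S m)) by (apply Rmult_le_pos; trivial).
    assert (0 <= ((a + b) / (c + b) - a / c) * PS_mult P Q m)
      by (apply Rmult_le_pos; lra).
    assert (0 <= (INR (S m) + c) * (PS_mult P z (S m) - PS_mult y Q (S m))) by lra.
    apply Rnot_lt_le. intros Hlt.
    assert (0 < (INR (S m) + c) * - (PS_mult P z (S m) - PS_mult y Q (S m)))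
      by (apply Rmult_lt_0_compat; lra).
    lra.
Qed.

(** * The shift by one *)

(** The coefficients of [x^m] on the two sides differ by
    [sum_k f k * f (m - k) * M k].  Pairing [k] with [m - k] turns [M] into
    terms that change sign at most once, from negative to nonnegative, on the
    way from the ends to the middle of the range; there [f k * f (m - k)] is
    largest.  Hence it suffices to know the sign for constant [f], which is the
    inequality for Kummer's function. *)
Lemma log_concave_kummer_turan (f : nat -> R) (a c b : R) (m : nat) :
  log_concave_seq f -> no_internal_zeros f ->
  0 < a -> a <= c -> 0 <= b ->
  PS_mult (fun n => f n * kummer_coef a c n)
          (fun n => f n * kummer_coef (a + b + 1) (c + b + 1) n) m
  <= PS_mult (fun n => f n * kummer_coef (a + 1) (c + 1) n)
             (fun n => f n * kummer_coef (a + b) (c + b) n) m.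
Proof.
  intros Hf Hz Ha Hac Hb.
  pose proof Hf as (Hpos & _).
  set (u := kummer_coef a c). set (v := kummer_coef (a + b) (c + b)).
  set (s := shift_factor a c). set (r := shift_factor (a + b) (c + b)).
  set (rho := fun n => v n / u n).
  assert (Hu : forall n, 0 < u n).
  { intros n. apply Rdiv_lt_0_compat; [apply poch_ratio_pos; lra|apply INR_fact_lt_0]. }
  assert (Hv : forall n, 0 < v n).
  { intros n. apply Rdiv_lt_0_compat; [apply poch_ratio_pos; lra|apply INR_fact_lt_0]. }
  assert (Hrho : forall n, 0 <= rho n <= rho (S n)).
  { intros n. pose proof (pos_INR n).
    assert (H0 : 0 < rho n) by (apply Rdiv_lt_0_compat; auto).
    assert (E : rho (S n) = rho n *
      (((a + b + INR n) / (c + b + INR n)) / ((a + INR n) / (c + INR n)))).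
    { unfold rho, u, v, kummer_coef. rewrite !poch_ratio_S by lra.
      pose proof (poch_ratio_pos a c n Ha ltac:(lra)).
      pose proof (INR_fact_neq_0 n). pose proof (INR_fact_neq_0 (S n)).
      field. repeat split; lra. }
    split; [lra|]. rewrite E.
    pose proof (fraction_shift_le (a + INR n) (c + INR n) b ltac:(lra) ltac:(lra) Hb) as F.
    replace (a + INR n + b) with (a + b + INR n) in F by ring.
    replace (c + INR n + b) with (c + b + INR n) in F by ring.
    assert (0 < (a + INR n) / (c + INR n)) by (apply Rdiv_lt_0_compat; lra).
    assert (1 <= ((a + b + INR n) / (c + b + INR n)) / ((a + INR n) / (c + INR n)))
      by (apply Rle_div_r; lra).
    nra. }
  (* [shift_factor] turns every parameter raised by one back into [u] or [v],
     and [rho] turns [v] into [u]: both pairings share the factor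
     [u k * u (m - k)], which leaves the expression of [symmetrised_sign]. *)
  set (M := fun k => u k * s k * v (m - k)%nat - u k * (v (m - k)%nat * r (m - k)%nat)).
  set (g := fun k => f k * f (m - k)%nat).
  set (A := fun k => M k + M (m - k)%nat).
  set (B := fun k => rho k * (s (m - k)%nat - r k)
                     + rho (m - k)%nat * (s k - r (m - k)%nat)).
  assert (HAB : forall k, (k <= m)%nat -> A k = u k * u (m - k)%nat * B k).
  { intros k Hk. unfold A, M, B, rho. replace (m - (m - k))%nat with k by lia.
    pose proof (Hu k). pose proof (Hu (m - k)%nat). field. lra. }
  assert (Hfold : forall i, (i <= m)%nat ->
    exists k, (2 * k <= m)%nat /\ g k = g i /\ B k = B i).
  { intros i Hi. destruct (Nat.le_gt_cases (2 * i) m) as [H|H].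
    - exists i. auto.
    - exists (m - i)%nat. split; [lia|]. unfold g, B.
      replace (m - (m - i))%nat with i by lia. split; ring. }
  assert (HM : 0 <= sum_f_R0 M m).
  { pose proof (kummer_turan a c b m Ha Hac Hb) as H. unfold PS_mult in H.
    apply Rminus_le_0 in H. rewrite <- minus_sum in H.
    erewrite sum_eq; [exact H|]. intros k Hk. cbv beta.
    rewrite !kummer_coef_shift by lra. unfold M, u, v, s, r. ring. }
  assert (HA : 0 <= sum_f_R0 A m).
  { unfold A. rewrite plus_sum, (sum_rev M). lra. }
  assert (HgA : 0 <= sum_f_R0 (fun k => g k * A k) m).
  { apply sum_weighted_nonneg; trivial.
    - intros k _. apply Rmult_le_pos; trivial.
    - intros i j Hi Hj HAi HAj.
      assert (Pi : 0 < u i * u (m - i)%nat) by (apply Rmult_lt_0_compat; auto).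
      assert (Pj : 0 < u j * u (m - j)%nat) by (apply Rmult_lt_0_compat; auto).
      rewrite HAB in HAi, HAj by trivial.
      assert (HBi : B i < 0) by (apply Rnot_le_lt; intro; nra).
      assert (HBj : 0 <= B j) by (apply Rnot_lt_le; intro; nra).
      destruct (Hfold i Hi) as (i' & Hi' & <- & EBi). rewrite <- EBi in HBi.
      destruct (Hfold j Hj) as (j' & Hj' & <- & EBj). rewrite <- EBj in HBj.
      destruct (Nat.le_gt_cases i' j') as [Hle|Hgt].
      + apply log_concave_unimodal; trivial.
      + exfalso. apply (Rlt_not_le _ _ HBi).
        apply (symmetrised_sign rho s r m) with (i := j'); trivial; try lia.
        * intros n. apply shift_factor_mono; lra.
        * intros n. apply shift_factor_mono; lra.
        * intros n. apply shift_factor_antitone; lra.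
        * intros n. apply shift_factor_gap_concave; lra. }
  assert (E : sum_f_R0 (fun k => g k * A k) m = 2 * sum_f_R0 (fun k => g k * M k) m).
  { rewrite <- (sum_eq (fun k => g k * M k + g (m - k)%nat * M (m - k)%nat)).
    - rewrite plus_sum, (sum_rev (fun k => g k * M k)). ring.
    - intros k Hk. unfold A, g. replace (m - (m - k))%nat with k by lia. ring. }
  apply Rminus_le_0. unfold PS_mult. rewrite <- minus_sum.
  rewrite <- (sum_eq (fun k => g k * M k)); [lra|].
  intros k Hk. rewrite !kummer_coef_shift by lra. unfold g, M, u, v, s, r. ring.
Qed.

Lemma f_coef_kummer (f : nat -> R) (a c mu : R) :
  f_coef f a c mu = fun n => f n * kummer_coef (a + mu) (c + mu) n.
Proof.
  apply functional_extensionality. intros n.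
  unfold f_coef, kummer_coef, poch_ratio, Rdiv. ring.
Qed.

Lemma f_coef_nonneg (f : nat -> R) (a c mu : R) :
  log_concave_seq f -> 0 < a -> a <= c -> 0 <= mu -> nonneg_coefs (f_coef f a c mu).
Proof.
  intros (Hf & _) Ha Hac Hmu n. rewrite f_coef_kummer.
  apply Rmult_le_pos; [apply Hf|apply kummer_coef_nonneg; lra].
Qed.

(** * Shifts by a positive integer *)

(** Going from [(mu, mu + alpha + beta)] to [(mu + alpha, mu + beta)] by moving
    both parameters by one, [alpha] times.  The condition
    [alpha - 1 <= beta] keeps their distance at least one before each move. *)
Lemma f_coef_q_log_concave (f : nat -> R) (a c : R) (n : nat) :
  log_concave_seq f -> no_internal_zeros f -> 0 < a -> a <= c ->
  forall (alpha : nat) (beta mu : R), INR alpha - 1 <= beta -> 0 <= mu ->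
  PS_mult (f_coef f a c mu) (f_coef f a c (mu + INR alpha + beta)) n
  <= PS_mult (f_coef f a c (mu + INR alpha)) (f_coef f a c (mu + beta)) n.
Proof.
  intros Hf Hz Ha Hac alpha.
  induction alpha as [|alpha IH]; intros beta mu Hbeta Hmu.
  - simpl. rewrite Rplus_0_r. lra.
  - rewrite S_INR in *. pose proof (pos_INR alpha).
    apply Rle_trans with (PS_mult (f_coef f a c (mu + INR alpha))
                                  (f_coef f a c (mu + (beta + 1))) n).
    + specialize (IH (beta + 1) mu ltac:(lra) Hmu).
      replace (mu + (INR alpha + 1) + beta) with (mu + INR alpha + (beta + 1)) by ring.
      exact IH.
    + pose proof (log_concave_kummer_turan f (a + (mu + INR alpha)) (c + (mu + INR alpha))
        (beta - INR alpha) n Hf Hz ltac:(lra) ltac:(lra) ltac:(lra)) as H1.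
      rewrite !f_coef_kummer.
      replace (a + (mu + (beta + 1))) with (a + (mu + INR alpha) + (beta - INR alpha) + 1) by ring.
      replace (c + (mu + (beta + 1))) with (c + (mu + INR alpha) + (beta - INR alpha) + 1) by ring.
      replace (a + (mu + beta)) with (a + (mu + INR alpha) + (beta - INR alpha)) by ring.
      replace (c + (mu + beta)) with (c + (mu + INR alpha) + (beta - INR alpha)) by ring.
      replace (a + (mu + (INR alpha + 1))) with (a + (mu + INR alpha) + 1) by ring.
      replace (c + (mu + (INR alpha + 1))) with (c + (mu + INR alpha) + 1) by ring.
      exact H1.
Qed.

(** For a positive function the shift by one says that [F (mu + 1) / F mu]
    does not increase with [mu]; a shift by [alpha] is a product of such ratios. *)
Lemma Wright_log_concave_of_unit_shift (F : R -> R) :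
  (forall mu, 0 <= mu -> 0 < F mu) ->
  (forall mu beta, 0 <= mu -> 0 <= beta ->
     F mu * F (mu + 1 + beta) <= F (mu + 1) * F (mu + beta)) ->
  discrete_Wright_log_concave F.
Proof.
  intros Hpos H1. split; [intros mu Hmu; apply Rlt_le; auto|].
  intros alpha mu beta _ Hmu Hbeta.
  induction alpha as [|alpha IH].
  - simpl. rewrite Rplus_0_r. lra.
  - rewrite S_INR. pose proof (pos_INR alpha).
    specialize (H1 (mu + INR alpha) beta ltac:(lra) Hbeta).
    replace (mu + (INR alpha + 1)) with (mu + INR alpha + 1) by ring.
    assert (P1 := Hpos mu Hmu).
    assert (P2 := Hpos (mu + INR alpha) ltac:(lra)).
    assert (P3 := Hpos (mu + INR alpha + beta) ltac:(lra)).
    assert (P4 := Hpos (mu + INR alpha + 1 + beta) ltac:(lra)).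
    assert (P5 := Hpos (mu + INR alpha + 1) ltac:(lra)).
    assert (P6 := Hpos (mu + beta) ltac:(lra)).
    apply Rmult_le_reg_l with (F (mu + INR alpha) * F (mu + INR alpha + beta));
      [apply Rmult_lt_0_compat; trivial|].
    pose proof (Rmult_le_compat _ _ _ _
      (Rlt_le _ _ (Rmult_lt_0_compat _ _ P1 P3)) (Rlt_le _ _ (Rmult_lt_0_compat _ _ P2 P4))
      IH H1). lra.
Qed.

(** * Entire power series with nonnegative coefficients *)

Lemma CV_radius_infinite_of_summable (p : nat -> R) :
  (forall x, ex_series (fun n => p n * x ^ n)) -> CV_radius p = p_infty.
Proof.
  intros H.
  assert (Hout : forall x, 0 <= x -> ~ Rbar_lt (CV_radius p) x).
  { intros x Hx Hlt. apply (CV_disk_outside p x).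
    - rewrite Rabs_pos_eq; trivial.
    - apply ex_series_lim_0, H. }
  destruct (CV_radius p) as [r| |]; [|reflexivity|].
  - exfalso. pose proof (Rabs_pos r). apply (Hout (Rabs r + 1)); [lra|].
    simpl. pose proof (Rle_abs r). lra.
  - exfalso. apply (Hout 0); [lra|exact I].
Qed.

Lemma entire_inside (p : nat -> R) (x : R) :
  CV_radius p = p_infty -> Rbar_lt (Rabs x) (CV_radius p).
Proof. intros ->. exact I. Qed.

Lemma entire_summable (p : nat -> R) (x : R) :
  CV_radius p = p_infty -> ex_series (fun n => p n * x ^ n).
Proof. intros Hp. apply ex_pseries_R, CV_radius_inside, entire_inside, Hp. Qed.

Lemma PS_mult_entire (p q : nat -> R) :
  CV_radius p = p_infty -> CV_radius q = p_infty -> CV_radius (PS_mult p q) = p_infty.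
Proof.
  intros Hp Hq. apply CV_radius_infinite_of_summable. intros x.
  apply ex_pseries_R, ex_pseries_mult; apply entire_inside; trivial.
Qed.

Lemma PS_minus_entire (p q : nat -> R) :
  CV_radius p = p_infty -> CV_radius q = p_infty -> CV_radius (PS_minus p q) = p_infty.
Proof.
  intros Hp Hq. apply CV_radius_infinite_of_summable. intros x.
  apply ex_pseries_R, (ex_pseries_minus (V := R_NormedModule) p q x);
    apply CV_radius_inside, entire_inside; trivial.
Qed.

Lemma PSeries_nonneg (p : nat -> R) (x : R) :
  nonneg_coefs p -> CV_radius p = p_infty -> 0 <= x -> 0 <= PSeries p x.
Proof.
  intros Hp Hr Hx. rewrite <- (PSeries_const_0 x). apply Series_le.
  - intros n. rewrite Rmult_0_l. split; [lra|].
    apply Rmult_le_pos; [apply Hp|apply pow_le; trivial].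
  - apply entire_summable; trivial.
Qed.

Lemma PSeries_pos (p : nat -> R) (N : nat) (x : R) :
  nonneg_coefs p -> CV_radius p = p_infty -> 0 < p N -> 0 < x -> 0 < PSeries p x.
Proof.
  intros Hp Hr HN Hx.
  assert (Ht : forall n, 0 <= p n * x ^ n).
  { intros n. apply Rmult_le_pos; [apply Hp|apply pow_le; lra]. }
  assert (Hs := entire_summable p x Hr).
  unfold PSeries. rewrite (Series_incr_n _ (S N)) by (trivial; lia).
  simpl pred.
  assert (H1 : 0 < sum_f_R0 (fun k => p k * x ^ k) N).
  { assert (0 < p N * x ^ N) by (apply Rmult_lt_0_compat; [|apply pow_lt]; trivial).
    destruct N as [|N]; [trivial|]. cbn [sum_f_R0].
    pose proof (cond_pos_sum _ N Ht). lra. }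
  assert (H2 : 0 <= Series (fun k => p (S N + k)%nat * x ^ (S N + k))).
  { apply Rle_trans with (Series (fun _ : nat => 0)).
    - right. transitivity (PSeries (fun _ => 0) 0); [symmetry; apply PSeries_const_0|].
      apply Series_ext. intros; ring.
    - apply Series_le; [intros n; split; [lra|apply Ht]|].
      apply (ex_series_incr_n (fun k => p k * x ^ k) (S N)). trivial. }
  lra.
Qed.

Lemma PSeries_absolutely_monotonic (p : nat -> R) :
  nonneg_coefs p -> CV_radius p = p_infty ->
  absolutely_monotonic (fun x => 0 < x) (PSeries p).
Proof.
  intros Hp Hr n x Hx. split.
  - apply ex_derive_n_PSeries, entire_inside; trivial.
  - rewrite Derive_n_PSeries by (apply entire_inside; trivial).
    apply PSeries_nonneg; [|rewrite CV_radius_derive_n; trivial|lra].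
    intros k. apply Rmult_le_pos; [|apply Hp].
    apply Rdiv_le_0_compat; [apply pos_INR|apply INR_fact_lt_0].
Qed.

(** Convexity of the exponential function, through its tangent at
    [l * U + (1 - l) * V]. *)
Lemma exp_convex (l U V : R) :
  0 <= l <= 1 -> exp (l * U + (1 - l) * V) <= l * exp U + (1 - l) * exp V.
Proof.
  intros Hl. set (W := l * U + (1 - l) * V).
  replace U with (W + (U - W)) at 1 by ring.
  replace V with (W + (V - W)) at 1 by ring.
  rewrite !exp_plus.
  pose proof (exp_pos W) as HW.
  pose proof (exp_ineq1_le (U - W)) as HU. pose proof (exp_ineq1_le (V - W)) as HV.
  assert (H : 1 <= l * exp (U - W) + (1 - l) * exp (V - W)).
  { apply Rle_trans with (l * (1 + (U - W)) + (1 - l) * (1 + (V - W))).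
    - unfold W. right. ring.
    - apply Rplus_le_compat; apply Rmult_le_compat_l; lra. }
  apply Rmult_le_compat_l with (r := exp W) in H; lra.
Qed.

Lemma real_power_pos_base (x l : R) : 0 < x -> real_power x l = exp (l * ln x).
Proof. intros Hx. unfold real_power. destruct (Req_EM_T x 0); [lra|reflexivity]. Qed.

Lemma real_power_nonneg (x l : R) : 0 <= real_power x l.
Proof.
  unfold real_power. destruct (Req_EM_T x 0); [destruct (Req_EM_T l 0); lra|].
  apply Rlt_le, exp_pos.
Qed.

(** Hoelder's inequality for the sums of [p n * x ^ n] and [p n * y ^ n], in the
    usual way from Young's inequality for the terms divided by the sums. *)
Lemma PSeries_multiplicatively_convex (p : nat -> R) :
  nonneg_coefs p -> CV_radius p = p_infty ->
  multiplicatively_convex (fun x => 0 < x) (PSeries p).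
Proof.
  intros Hp Hr. split; [intros; apply PSeries_nonneg; trivial; lra|].
  intros x y l Hx Hy Hl.
  destruct (classic (exists N, p N <> 0)) as [(N & HN)|Hnone].
  2: { replace (PSeries p (real_power x l * real_power y (1 - l))) with 0.
       - apply Rmult_le_pos; apply real_power_nonneg.
       - rewrite <- (PSeries_const_0 (real_power x l * real_power y (1 - l))).
         apply PSeries_ext. intros n. apply NNPP. intros Hn. apply Hnone.
         exists n. auto. }
  assert (HN' : 0 < p N) by (specialize (Hp N); lra).
  pose proof (PSeries_pos p N x Hp Hr HN' Hx) as PX.
  pose proof (PSeries_pos p N y Hp Hr HN' Hy) as PY.
  set (X := PSeries p x) in *. set (Y := PSeries p y) in *.
  rewrite !real_power_pos_base by trivial. rewrite <- !exp_plus.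
  set (t := exp (l * ln x + (1 - l) * ln y)).
  set (Z := exp (l * ln X + (1 - l) * ln Y)).
  assert (HZ : 0 < Z) by apply exp_pos.
  assert (Hterm : forall n, p n * t ^ n
    <= Z * l / X * (p n * x ^ n) + Z * (1 - l) / Y * (p n * y ^ n)).
  { intros n.
    assert (Ht : t ^ n = exp (INR n * (l * ln x + (1 - l) * ln y))).
    { rewrite <- (exp_ln (t ^ n)) by (apply pow_lt, exp_pos).
      rewrite ln_pow by apply exp_pos. unfold t. rewrite ln_exp. reflexivity. }
    assert (H := exp_convex l (INR n * ln x - ln X) (INR n * ln y - ln Y) Hl).
    assert (Hq : forall w W, 0 < w -> 0 < W -> exp (INR n * ln w - ln W) = w ^ n / W).
    { intros w W Hw HW. rewrite <- ln_pow by trivial.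
      rewrite <- ln_div by (trivial; apply pow_lt; trivial).
      apply exp_ln, Rdiv_lt_0_compat; [apply pow_lt|]; trivial. }
    rewrite (Hq x X), (Hq y Y) in H by trivial.
    replace (t ^ n) with
      (Z * exp (l * (INR n * ln x - ln X) + (1 - l) * (INR n * ln y - ln Y))).
    - apply Rmult_le_compat_l with (r := p n * Z) in H;
        [|apply Rmult_le_pos; [apply Hp|lra]].
      unfold Rdiv in *. lra.
    - rewrite Ht. unfold Z. rewrite <- exp_plus. f_equal. ring. }
  assert (Sx := entire_summable p x Hr). assert (Sy := entire_summable p y Hr).
  apply Rle_trans with (Series (fun n =>
    Z * l / X * (p n * x ^ n) + Z * (1 - l) / Y * (p n * y ^ n))).
  - apply Series_le.
    + intros n. split; [|apply Hterm].
      apply Rmult_le_pos; [apply Hp|]. apply Rlt_le, pow_lt, exp_pos.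
    + apply (ex_series_plus (V := R_NormedModule));
        apply (ex_series_scal (V := R_NormedModule)); trivial.
  - rewrite Series_plus, !Series_scal_l.
    + fold (PSeries p x). fold (PSeries p y). fold X. fold Y.
      right. field. lra.
    + apply (ex_series_scal (V := R_NormedModule)); trivial.
    + apply (ex_series_scal (V := R_NormedModule)); trivial.
Qed.

(** * The family of series *)

Lemma f_coef_entire (f : nat -> R) (a c mu : R) :
  log_concave_seq f -> no_internal_zeros f -> 0 < a -> a <= c -> 0 <= mu ->
  CV_radius (f_coef f a c mu) = p_infty.
Proof.
  intros Hf Hz Ha Hac Hmu. apply CV_radius_infinite_of_summable. intros x.
  destruct (log_concave_geometric_bound f Hf Hz) as (C & K & HC & HK & Hbound).
  apply (ex_series_le (V := R_CompleteNormedModule) _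
    (fun n => C * (/ INR (fact n) * (K * Rabs x) ^ n))).
  - intros n. change norm with Rabs. rewrite f_coef_kummer.
    unfold kummer_coef.
    rewrite !Rabs_mult, <- RPow_abs, Rpow_mult_distr.
    pose proof (proj1 Hf n) as Pf. pose proof (Hbound n) as Bf.
    pose proof (poch_ratio_pos (a + mu) (c + mu) n ltac:(lra) ltac:(lra)).
    pose proof (poch_ratio_le_1 (a + mu) (c + mu) n ltac:(lra) ltac:(lra)).
    pose proof (Rinv_0_lt_compat _ (INR_fact_lt_0 n)).
    pose proof (pow_le _ n (Rabs_pos x)).
    rewrite (Rabs_pos_eq (f n)), (Rabs_pos_eq (poch_ratio _ _ _ / _))
      by (trivial; apply Rmult_le_pos; lra).
    replace (C * (/ INR (fact n) * (K ^ n * Rabs x ^ n)))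
      with (C * K ^ n * (1 * / INR (fact n)) * Rabs x ^ n) by ring.
    apply Rmult_le_compat_r; [trivial|].
    apply Rmult_le_compat; trivial; [apply Rmult_le_pos; lra|].
    apply Rmult_le_compat_r; lra.
  - apply (ex_series_scal (V := R_NormedModule)), ex_pseries_R.
    eexists. apply is_exp_Reals.
Qed.

Lemma f_coef_continuous (f : nat -> R) (a c : R) (n : nat) :
  0 < a -> a <= c ->
  continuous_on (fun mu : R => 0 <= mu) (fun mu : R => f_coef f a c mu n).
Proof.
  intros Ha Hac. apply continuous_on_forall. intros mu Hmu.
  assert (Hrise : forall e, continuity_pt (fun t => rising (e + t) n) mu).
  { intros e. induction n as [|k IH]; simpl.
    - apply continuity_pt_const. intros t t'. reflexivity.
    - apply (continuity_pt_mult (fun t => rising (e + t) k) (fun t => e + t + INR k)); trivial.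
      apply derivable_continuous_pt. reg. }
  apply continuity_pt_filterlim. unfold f_coef, Rdiv.
  apply (continuity_pt_mult (fun t => f n * (rising (a + t) n * / rising (c + t) n))
           (fun _ => / INR (fact n)));
    [|apply continuity_pt_const; intros t t'; reflexivity].
  apply (continuity_pt_mult (fun _ => f n) (fun t => rising (a + t) n * / rising (c + t) n));
    [apply continuity_pt_const; intros t t'; reflexivity|].
  apply (continuity_pt_mult (fun t => rising (a + t) n) (fun t => / rising (c + t) n));
    [apply Hrise|].
  apply (continuity_pt_inv (fun t => rising (c + t) n)); [apply Hrise|].
  pose proof (rising_pos (c + mu) n ltac:(lra)). lra.
Qed.

Lemma f_val_Wright_log_concave (f : nat -> R) (a c x : R) :
  log_concave_seq f -> no_internal_zeros f -> 0 < a -> a <= c -> 0 < x ->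
  discrete_Wright_log_concave (fun mu => f_val f a c mu x).
Proof.
  intros Hf Hz Ha Hac Hx. apply Wright_log_concave_of_unit_shift.
  - intros mu Hmu. pose proof Hf as (Hpos & (N & HN) & _).
    apply PSeries_pos with N; trivial.
    + apply f_coef_nonneg; trivial.
    + apply f_coef_entire; trivial.
    + rewrite f_coef_kummer. apply Rmult_lt_0_compat; [specialize (Hpos N); lra|].
      apply Rdiv_lt_0_compat; [apply poch_ratio_pos; lra|apply INR_fact_lt_0].
  - intros mu beta Hmu Hbeta. unfold f_val.
    assert (Hent : forall t, 0 <= t -> CV_radius (f_coef f a c t) = p_infty)
      by (intros; apply f_coef_entire; trivial).
    rewrite <- !PSeries_mult by (apply entire_inside, Hent; lra).
    apply Series_le.
    + intros n. split.
      * apply Rmult_le_pos; [|apply pow_le; lra].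
        apply PS_mult_nonneg; apply f_coef_nonneg; trivial; lra.
      * apply Rmult_le_compat_r; [apply pow_le; lra|].
        apply (f_coef_q_log_concave f a c n Hf Hz Ha Hac 1 beta mu); simpl; lra.
    + apply entire_summable, PS_mult_entire; apply Hent; lra.
Qed.

Lemma phi_coef_nonneg (f : nat -> R) (a c : R) (nu : nat) (mu : R) :
  log_concave_seq f -> no_internal_zeros f -> 0 < a -> a <= c ->
  INR nu - 1 <= mu -> nonneg_coefs (phi_coef f a c mu (INR nu)).
Proof.
  intros Hf Hz Ha Hac Hmu n.
  pose proof (f_coef_q_log_concave f a c n Hf Hz Ha Hac nu mu 0 Hmu ltac:(lra)) as H.
  rewrite !Rplus_0_l, PS_mult_comm with (p := f_coef f a c (INR nu)) in H.
  unfold phi_coef, PS_minus, plus, opp; simpl. rewrite (Rplus_comm mu). lra.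
Qed.

Lemma phi_coef_entire (f : nat -> R) (a c mu nu : R) :
  log_concave_seq f -> no_internal_zeros f -> 0 < a -> a <= c ->
  0 <= mu -> 0 <= nu -> CV_radius (phi_coef f a c mu nu) = p_infty.
Proof.
  intros. apply PS_minus_entire; apply PS_mult_entire; apply f_coef_entire; trivial; lra.
Qed.

Lemma phi_val_PSeries (f : nat -> R) (a c mu nu : R) :
  log_concave_seq f -> no_internal_zeros f -> 0 < a -> a <= c ->
  0 <= mu -> 0 <= nu ->
  (fun x => phi_val f a c mu nu x) = PSeries (phi_coef f a c mu nu).
Proof.
  intros Hf Hz Ha Hac Hmu Hnu. apply functional_extensionality. intros x.
  assert (Hent : forall t, 0 <= t -> CV_radius (f_coef f a c t) = p_infty)
    by (intros; apply f_coef_entire; trivial).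
  unfold phi_val, f_val, phi_coef.
  rewrite PSeries_minus, !PSeries_mult; try reflexivity;
    try apply ex_pseries_mult; apply entire_inside, Hent; lra.
Qed.

Theorem theorem1 (a c : R) (f : nat -> R)
    (ha : 0 < a) (hac : a <= c)
    (hf : log_concave_seq f) (hz : no_internal_zeros f) :
  (* the series converge for every x, so that the functions of x below are
     genuine sums on (0, oo) *)
  (forall mu : R, 0 <= mu -> CV_radius (f_coef f a c mu) = p_infty) /\
  (forall x : R, 0 < x ->
     discrete_Wright_log_concave (fun mu : R => f_val f a c mu x)) /\
  discrete_q_log_concave (f_coef f a c) /\
  (forall (nu : nat) (mu : R), (1 <= nu)%nat -> INR nu - 1 <= mu ->
     nonneg_coefs (phi_coef f a c mu (INR nu)) /\
     absolutely_monotonic (fun x : R => 0 < x)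
       (fun x : R => phi_val f a c mu (INR nu) x) /\
     multiplicatively_convex (fun x : R => 0 < x)
       (fun x : R => phi_val f a c mu (INR nu) x)).
Proof.
  split; [|split; [|split]].
  - intros mu Hmu. apply f_coef_entire; trivial.
  - intros x Hx. apply f_val_Wright_log_concave; trivial.
  - split; [|split].
    + intros mu Hmu. apply f_coef_nonneg; trivial.
    + intros n. apply f_coef_continuous; trivial.
    + intros alpha beta mu _ Hbeta Hmu n.
      unfold PS_minus, plus, opp; simpl. apply Rle_minus_r. rewrite Rplus_0_l.
      apply f_coef_q_log_concave; trivial.
  - intros nu mu Hnu Hmu.
    assert (Hnu1 : 1 <= INR nu) by (apply (le_INR 1); trivial).
    pose proof (phi_coef_nonneg f a c nu mu hf hz ha hac Hmu) as Hphi.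
    pose proof (phi_coef_entire f a c mu (INR nu) hf hz ha hac ltac:(lra) ltac:(lra)) as Hent.
    rewrite phi_val_PSeries by (trivial; lra).
    split; [|split]; trivial.
    + apply PSeries_absolutely_monotonic; trivial.
    + apply PSeries_multiplicatively_convex; trivial.
Qed.
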